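(* For every function $f\colon\mathbb{R}^2\to\mathbb{R}$, the set $TFC(f)$ is residual in $\mathbb{R}^2$ and has full Lebesgue measure. If moreover $f$ is Borel, then the set $TFC(f)$ is analytic.
   Context: Notation: $x_n\searrow x$ means that $(x_n)$ is a strictly decreasing sequence of reals converging to $x$. A function $f\colon\mathbb{R}^2\to\mathbb{R}$ is two-feebly continuous at $\langle x,y\rangle$ if there exist sequences $x_n\searrow x$ and $y_n\searrow y$ such that $\lim_{n\to\infty}f(x_n,y_n)=f(x,y)$. $TFC(f)$ denotes the set of all points of $\mathbb{R}^2$ at which $f$ is two-feebly continuous. A set is residual if its complement is meager, and has full Lebesgue measure if its complement has Lebesgue measure zero. *)

(* Defs.v *)
(* The real line is an arbitrary [R : realType] and the plane is [R * R] with
   the product topology. *)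
From HB Require Import structures.
From mathcomp Require Import all_boot all_order all_algebra.
From mathcomp Require Import all_classical all_reals all_analysis.
Import Order.TTheory GRing.Theory Num.Theory.
Import numFieldNormedType.Exports.

Set Implicit Arguments.
Unset Strict Implicit.
Unset Printing Implicit Defensive.

Local Open Scope classical_set_scope.
Local Open Scope ring_scope.

(* [decreasing_seq] is the strict notion: u m <= u n iff n <= m. *)
Definition strictly_decreases_to (R : realType) (u : R^nat) (x : R) : Prop :=
  decreasing_seq u /\ u @ \oo --> x.

Definition two_feebly_continuous_at (R : realType) (f : R * R -> R)
    (p : R * R) : Prop :=
  exists u v : R^nat,
    [/\ strictly_decreases_to u p.1,
        strictly_decreases_to v p.2 &
        f (u n, v n) @[n --> \oo] --> f p].

Definition TFC (R : realType) (f : R * R -> R) : set (R * R) :=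
  [set p | two_feebly_continuous_at f p].

Definition nowhere_dense (T : topologicalType) (A : set T) : Prop :=
  (closure A)° = set0.

Definition meager (T : topologicalType) (A : set T) : Prop :=
  exists2 F : (set T)^nat, (forall n, nowhere_dense (F n)) & A = \bigcup_n F n.

Definition residual (T : topologicalType) (A : set T) : Prop := meager (~` A).

(* A null set need not be measurable, hence [negligible]: it is contained in
   a Borel set of measure zero. *)
Definition full_lebesgue_measure (R : realType) (A : set (R * R)) : Prop :=
  (@lebesgue_measure R \x @lebesgue_measure R)%E.-negligible (~` A).

(* The domain carries the sigma-algebra generated by the open sets of the
   plane; [measurableTypeR R] is the line with its Borel sigma-algebra. *)
Definition borel_function (R : realType) (f : R * R -> R) : Prop :=
  measurable_fun setT
    (f : g_sigma_algebraType (@open (R * R)%type) -> measurableTypeR R).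

Definition separable (T : topologicalType) : Prop :=
  exists2 D : set T, countable D & dense D.

(* Continuous image of a Polish space. A Polish space is presented as a complete
   pseudometric space that is Hausdorff (so the pseudometric is a metric) and
   separable; [completePseudoMetricType] is pointed, hence nonempty, so the
   empty Polish space is accounted for by the case [A = set0]. *)
Definition analytic (R : realType) (T : topologicalType) (A : set T) : Prop :=
  A = set0 \/
  exists (P : completePseudoMetricType R) (g : P -> T),
    [/\ hausdorff_space P, separable P, continuous g & A = range g].

(* Main.v *)
Require Import Defs.
From HB Require Import structures.
From mathcomp Require Import all_boot all_order all_algebra.
From mathcomp Require Import all_classical all_reals all_analysis.
From mathcomp Require Import borel_hierarchy lra.
Import Order.TTheory GRing.Theory Num.Theory.
Import numFieldNormedType.Exports.

Set Implicit Arguments.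
Unset Strict Implicit.
Unset Printing Implicit Defensive.

Local Open Scope classical_set_scope.
Local Open Scope ring_scope.

(** Write [p <_e q] when both coordinates of [q] exceed those of [p] by less
than [e]; being in TFC(f) means that for every [e] some [q] with [p <_e q] has
a value within [e] of [f p] ([TFCP]).  Cut the range of [f] by rational
intervals: for every [n] let the sets [B] run over the countably many preimages
of rational intervals of length [1/(n+1)], which cover the plane, and let
[shadow e B] be the set of points [p] with [p <_e q] for some [q] in [B].  Then
[[
   TFC(f) = \bigcap_n \bigcup_B (B `&` shadow (1/(n+1)) B)
]]
([TFC_bands]).  Two facts about this formula give the theorem.

The complement of TFC(f) is covered by the countably many sets
[B `\` shadow e B].  Such a set is a local antichain: it has no two points with
[p <_e q].  This survives closure, since [<_e] is an open relation.  A closed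
local antichain has empty interior, as an open set contains pairs along the
diagonal direction; so the complement is meager.  It is also null: if two
points [y < z] lie close together on the vertical section at [x], any rational
between them lies in no such gap for another nearby abscissa, so only countably
many sections contain close pairs, and all other sections are countable.
Integrating the measure of the sections gives zero
([antichain_negligible]).

The shadow of an arbitrary set is open, as a union of open boxes.  Hence if [f]
is Borel, TFC(f) is even a Borel set, and it remains to see that Borel subsets
of a Polish space [X] are analytic ([borel_analytic]).  Projections to [X] of
closed subsets of [X * nat^nat] are closed under countable unions and
intersections, by coding sequences of elements of Baire space into one element,
and contain the closed and the open sets; so the sets which are such
projections together with their complements form a sigma-algebra containing the
open sets.  Finally a closed subset of [X * nat^nat] is itself Polish, and the
projection is continuous. *)

(** * Countable unions and neighborhoods in products *)

(** Turns unions over an arbitrary countable type into the unions of sequences in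
terms of which meager sets and sigma-additivity are stated. *)
Lemma bigcup_unpickle (I : countType) (T : Type) (F : I -> set T) :
  \bigcup_i F i = \bigcup_n oapp F set0 (unpickle n).
Proof.
apply/seteqP; split=> [x [i _ Fix]|x [n _]].
  by exists (pickle i); rewrite // pickleK.
by case: (unpickle n) => [i|] //= Fix; exists i.
Qed.

Lemma countable_bigcup_subsingletons (I : countType) (T : Type)
    (F : I -> set T) :
  (forall i x y, F i x -> F i y -> x = y) -> countable (\bigcup_i F i).
Proof.
move=> F1; apply: bigcup_countable => [|i _]; first exact: countableP.
have [[x Fx]|/forallNP F0] := pselect (exists x, F i x).
  by apply: (sub_countable _ (countable1 x)); apply: subset_card_le => y /F1;
    exact.
by rewrite (_ : F i = set0) //; apply/seteqP; split=> // x /F0.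
Qed.

Lemma meager_sub_bigcup (T : topologicalType) (I : countType) (A : set T)
    (F : I -> set T) : (forall i, nowhere_dense (F i)) ->
  A `<=` \bigcup_i F i -> meager A.
Proof.
move=> ndF AF; exists (fun n => A `&` oapp F set0 (unpickle n)); last first.
  by rewrite -setI_bigcupr -bigcup_unpickle; apply/esym/setIidPl.
move=> n; rewrite /nowhere_dense.
case: (unpickle n) => [i|] /=; last by rewrite setI0 closure0 interior0.
apply/seteqP; split=> //; rewrite -(ndF i).
apply: interiorS; apply: closureS; exact: subIsetr.
Qed.

Lemma near_fst (T U : topologicalType) (p : T * U) (A : set T) :
  nbhs p.1 A -> \forall q \near p, A q.1.
Proof. by move=> nA; apply: cvg_fst. Qed.

Lemma near_snd (T U : topologicalType) (p : T * U) (A : set U) :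
  nbhs p.2 A -> \forall q \near p, A q.2.
Proof. by move=> nA; apply: cvg_snd. Qed.

(** * Separable pseudometric spaces *)

(** A countable supply of balls that generates all neighborhoods; unlike a dense
set, it can be restricted to a subspace. *)
Lemma dense_balls (R : realType) (X : pseudoMetricType R) (D : set X) :
  dense D -> forall x U, nbhs x U -> exists d, exists n : nat,
    [/\ D d, ball d n.+1%:R^-1 x & ball d n.+1%:R^-1 `<=` U].
Proof.
move=> dD x U /nbhs_ballP[e /= e0 eU].
have e20 : 0 < e / 2 by lra.
have [n] := ltr_add_invr e20; rewrite add0r => ne.
have n0 : 0 < n.+1%:R^-1 :> R by rewrite invr_gt0.
have [d []] : ((ball x n.+1%:R^-1)° `&` D) !=set0.
  apply: dD; last exact: open_interior.
  by exists x; exact: nbhsx_ballx.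
move=> /interior_subset xd Dd.
exists d, n; split => //; first exact: ball_sym.
move=> y dy; apply: eU; apply: (@ball_split _ _ d).
  by apply: le_ball xd; exact: ltW.
by apply: le_ball dy; exact: ltW.
Qed.

Lemma dense_setX (X Y : topologicalType) (A : set X) (B : set Y) :
  dense A -> dense B -> dense (A `*` B).
Proof.
move=> dA dB O [[x y] Oxy] oO.
have [[U V] /= [xU yV] UV] := open_nbhs_nbhs (conj oO Oxy).
have [a [aU Aa]] : (U° `&` A) !=set0.
  by apply: dA; [exists x|exact: open_interior].
have [b [bV Bb]] : (V° `&` B) !=set0.
  by apply: dB; [exists y|exact: open_interior].
exists (a, b); split => //; apply: UV.
by split => /=; [exact: interior_subset aU|exact: interior_subset bV].
Qed.

Lemma separable_prod (X Y : topologicalType) :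
  separable X -> separable Y -> separable (X * Y)%type.
Proof.
move=> [A cA dA] [B cB dB]; exists (A `*` B); first exact: countableX.
exact: dense_setX.
Qed.

Lemma separable_real (R : realType) : separable R.
Proof.
exists (range ratr); last exact: dense_rat.
exact: sub_countable (card_image_le _ _) (countableP _).
Qed.

(** * A countable description of the two-feebly continuous points *)

Section two_feebly_continuous_points.
Variable R : realType.
Implicit Types (f : R * R -> R) (p q : R * R) (B : set (R * R)) (e : R).

(** The relation written [p <_e q] in the introduction. *)
Definition northeast e p q : Prop :=
  (p.1 < q.1 < p.1 + e) /\ (p.2 < q.2 < p.2 + e).

Definition shadow e B : set (R * R) := [set p | exists2 q, B q & northeast e p q].

Definition band f (n : nat) (r : rat) : set (R * R) :=
  [set p | `|f p - ratr r| < n.+1%:R^-1 / 2].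

Lemma strictly_decreases_to_gt (u : R^nat) (x : R) :
  strictly_decreases_to u x -> forall n, x < u n.
Proof.
move=> [du ux] n.
have nu : {homo u : n m / (n <= m)%N >-> m <= n} by move=> a b; rewrite du.
apply: (@le_lt_trans _ _ (u n.+1)); last first.
  by move/decreasing_seqP : du; apply.
rewrite -(cvg_lim _ ux) //; apply: nonincreasing_cvgn_ge => //.
by apply/cvg_ex; exists x.
Qed.

(** For the converse, choose [g e] in the box of size [e], and choose each point
with a tolerance at most both coordinate gaps between the previous point and
[p]; this forces strict decrease in both coordinates. *)
Lemma TFCP f p :
  TFC f p <-> forall e, 0 < e -> exists2 q, northeast e p q & `|f q - f p| < e.
Proof.
split=> [[u [v [ux vy fuv]]] e e0|H].
  have [ugt vgt] := (strictly_decreases_to_gt ux, strictly_decreases_to_gt vy).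
  have [[_ cu] [_ cv]] := (ux, vy).
  have : \forall n \near \oo, [/\ `|p.1 - u n| < e, `|p.2 - v n| < e &
      `|f p - f (u n, v n)| < e].
    by near=> n; split; near: n; apply: cvgr_dist_lt.
  case=> n _ /(_ n (leqnn n)) [un vn fn].
  exists (u n, v n); last by rewrite distrC.
  have := ugt n; have := vgt n; move: un vn.
  by rewrite /northeast /= !ltr_distlC => /andP[? ?] /andP[? ?] -> ->; split.
have /choice [g gP] : forall e, exists q, 0 < e ->
    northeast e p q /\ `|f q - f p| < e.
  move=> e; have [e0|_] := ltP 0 e; last by exists p.
  by have [q ? ?] := H _ e0; exists q.
pose gap q (n : nat) : R :=
  Num.min (Num.min (q.1 - p.1) (q.2 - p.2)) n.+1%:R^-1.
(* the tolerance used for the [n]-th point, and [g (E n)] is that point *)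
pose E := fix E n : R := if n is m.+1 then gap (g (E m)) n else 1.
have E0 n : 0 < E n.
  elim: n => [|n /gP[[/andP[h1 _] /andP[h2 _]] _]] /=; first by [].
  by rewrite /gap !lt_min !subr_gt0 h1 h2 invr_gt0 ltr0n.
have En n : E n <= n.+1%:R^-1.
  by case: n => [|n] /=; [rewrite invr1|rewrite /gap ge_min lexx orbT].
have decr n : (g (E n.+1)).1 < (g (E n)).1 /\ (g (E n.+1)).2 < (g (E n)).2.
  have [[/andP[_ h1] /andP[_ h2]] _] := gP _ (E0 n.+1).
  have : E n.+1 <= (g (E n)).1 - p.1 by rewrite /= /gap !ge_min lexx.
  have : E n.+1 <= (g (E n)).2 - p.2 by rewrite /= /gap !ge_min lexx !orbT.
  by move: h1 h2; move: (E n.+1) => z; split; lra.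
have squeeze (w : R^nat) (l : R) :
    (forall n, `|w n - l| < E n) -> w @ \oo --> l.
  move=> wE; apply/cvgrPdist_lt => d d0.
  have := @cvg_harmonic R; move/cvgrPdist_lt => /(_ _ d0).
  apply: filterS => n; rewrite sub0r normrN ger0_norm ?harmonic_ge0 // distrC.
  by apply: lt_trans; apply: lt_le_trans (wE n) (En n).
exists (fun n => (g (E n)).1), (fun n => (g (E n)).2); split.
- split; first by apply/decreasing_seqP => n; case: (decr n).
  apply: squeeze => n; have [[/andP[? ?] _] _] := gP _ (E0 n).
  by rewrite gtr0_norm; lra.
- split; first by apply/decreasing_seqP => n; case: (decr n).
  apply: squeeze => n; have [[_ /andP[? ?]] _] := gP _ (E0 n).
  by rewrite gtr0_norm; lra.
- apply: squeeze => n; have [_] := gP _ (E0 n).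
  by rewrite -surjective_pairing.
Unshelve. all: by end_near. Qed.

Lemma band_exists f (n : nat) p : exists r, band f n r p.
Proof.
have h0 : 0 < n.+1%:R^-1 / 2 :> R by rewrite divr_gt0 // invr_gt0.
have [||y [fy [r _ ry]]] := @dense_rat R (ball (f p) (n.+1%:R^-1 / 2)).
- by exists (f p); apply: ballxx.
- exact: ball_open.
by exists r; rewrite /band /= ry; exact: fy.
Qed.

(** Two points of one band have values less than [1/(n+1)] apart, which gives the
inclusion from right to left.  For the other one, given [p] and [n], pick a band
around [p] first: since its defining interval is open, it contains every [q]
whose value is close enough to [f p]. *)
Lemma TFC_bands f :
  TFC f = \bigcap_n \bigcup_r (band f n r `&` shadow n.+1%:R^-1 (band f n r)).
Proof.
apply/seteqP; split=> p.
  move=> /TFCP H n _.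
  have [r pr] := band_exists f n p; exists r => //; split => //.
  set h : R := n.+1%:R^-1.
  have h0 : 0 < h by rewrite invr_gt0.
  (* the tolerance keeps [f q] in the rational interval that contains [f p] *)
  have [|q [/andP[? q1] /andP[? q2]] fq] :=
      H (Num.min h (h / 2 - `|f p - ratr r|)).
    by rewrite lt_min h0 subr_gt0.
  move: q1 q2 fq; rewrite lt_min => q1 q2 /andP[_ fq].
  have mh : Num.min h (h / 2 - `|f p - ratr r|) <= h by rewrite ge_min lexx.
  exists q; last by split; apply/andP; split => //;
    rewrite (lt_le_trans q1, lt_le_trans q2) // lerD2l.
  by rewrite /band /= -/h; have := ler_distD (f p) (f q) (ratr r); lra.
move=> H; apply/TFCP => e e0.
have [n] := ltr_add_invr e0; rewrite add0r.
have [r _ [pr [q qr [/andP[q1 q1'] /andP[q2 q2']]]]] := H n I.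
set h : R := n.+1%:R^-1 in q1' q2' *; move=> he.
exists q; first by split; apply/andP; split => //; lra.
move: pr qr; rewrite /band /= -/h => pr qr.
have := ler_distD (ratr r) (f q) (f p); rewrite [`|ratr r - _|]distrC; lra.
Qed.

(** A point outside [B `&` shadow e B] for all bands [B] of one level [n] still
lies in some band of that level, and therefore outside its shadow. *)
Lemma setC_TFC f : ~` TFC f `<=`
  \bigcup_(nr : nat * rat)
    (band f nr.1 nr.2 `\` shadow nr.1.+1%:R^-1 (band f nr.1 nr.2)).
Proof.
move=> p; rewrite TFC_bands setC_bigcap => -[n _] H.
have [r pr] := band_exists f n p.
exists (n, r) => //; split => //= sp.
by apply: H; exists r.
Qed.

Lemma near_northeast_l e p q : northeast e p q ->
  \forall p' \near p, northeast e p' q.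
Proof.
move=> [/andP[h1 h2] /andP[h3 h4]].
near=> p'; split; apply/andP; split.
- by near: p'; exact: (near_fst (lt_nbhsl _)).
- rewrite -ltrBlDr; near: p'; apply: (near_fst (lt_nbhsr _)); lra.
- by near: p'; exact: (near_snd (lt_nbhsl _)).
- rewrite -ltrBlDr; near: p'; apply: (near_snd (lt_nbhsr _)); lra.
Unshelve. all: by end_near. Qed.

Lemma near_northeast_r e p q : northeast e p q ->
  \forall q' \near q, northeast e p q'.
Proof.
move=> [/andP[h1 h2] /andP[h3 h4]].
near=> q'; split; apply/andP; split.
- by near: q'; exact: (near_fst (lt_nbhsr _)).
- by near: q'; exact: (near_fst (lt_nbhsl _)).
- by near: q'; exact: (near_snd (lt_nbhsr _)).
- by near: q'; exact: (near_snd (lt_nbhsl _)).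
Unshelve. all: by end_near. Qed.

(** The set [B] is arbitrary: for fixed [q] the points [p] below [q] form an open
box, and the shadow is a union of such boxes. *)
Lemma open_shadow e B : open (shadow e B).
Proof.
rewrite openE => p [q Bq pq].
by rewrite /interior; apply: filterS (near_northeast_l pq) => p'; exists q.
Qed.

(** * Local antichains are nowhere dense and null *)

(** Antichains only at scale [e]: the boxes defining a shadow have size [e], so
such a set may well contain points far to the northeast of each other. *)
Definition local_antichain e (E : set (R * R)) :=
  forall p q, E p -> E q -> ~ northeast e p q.

Lemma antichain_setD_shadow e B : local_antichain e (B `\` shadow e B).
Proof. by move=> p q [_ Sp] [Bq _] pq; apply: Sp; exists q. Qed.

(** The relation [northeast e] is open in each argument, so a related pair in the
closure can be moved into [E], one point at a time. *)
Lemma antichain_closure e E :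
  local_antichain e E -> local_antichain e (closure E).
Proof.
move=> aE p q cp cq pq.
have [p' [Ep' p'q]] := cp _ (near_northeast_l pq).
have [q' [Eq' p'q']] := cq _ (near_northeast_r p'q).
exact: aE p'q'.
Qed.

Lemma antichain_nowhere_dense e E :
  0 < e -> local_antichain e E -> nowhere_dense E.
Proof.
move=> e0 /antichain_closure aE; apply/seteqP; split => // p.
rewrite /interior => Fp.
have /nbhs_ballP[d /= d0 dF] := Fp.
pose m := Num.min d e / 2.
have [m0 md me] : [/\ 0 < m, m < d & m < e].
  rewrite /m; have [mind mine] : Num.min d e <= d /\ Num.min d e <= e.
    by rewrite !ge_min !lexx orbT.
  have : 0 < Num.min d e by rewrite lt_min d0 e0.
  by move=> ?; split; lra.
apply: (aE p (p.1 + m, p.2 + m)); first exact: nbhs_singleton.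
  by apply: dF; split; rewrite /ball /= opprD addrA subrr sub0r normrN gtr0_norm.
by split; rewrite /= ltrDl m0 ltrD2l.
Qed.

(** If the section at [x] has two points [y < z] less than [e / 2] apart, record a
rational [b] between them, and a rational [a] locating [x] up to [e].  Two
abscissas [u < v] cannot share a record: with [y < b < z] at [u] and
[y' < b < z'] at [v], the points [(u, y)] and [(v, z')] would be related.  So
only countably many sections contain such a pair; any other section has at most
one point in each interval of length [e / 2], hence is countable. *)
Lemma antichain_xsection_countable e E : 0 < e -> local_antichain e E ->
  countable [set x | ~ countable [set y | E (x, y)]].
Proof.
move=> e0 aE.
pose F (ab : rat * rat) : set R := [set x |
  (ratr ab.1 < x < ratr ab.1 + e) /\
  exists y, exists z, [/\ E (x, y), E (x, z), y < ratr ab.2,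
   ratr ab.2 < z & z < y + e / 2]].
have ratI (a b : R) : a < b -> exists r : rat, a < ratr r < b.
  by move=> /rat_in_itvoo[r]; rewrite in_itv; exists r.
have cF : countable (\bigcup_ab F ab).
  apply: countable_bigcup_subsingletons => -[a b] x x'.
  have key u v : F (a, b) u -> F (a, b) v -> ~ u < v.
    move=> [/= /andP[? ?] [y [z [uy uz ? ? ?]]]].
    move=> [/= /andP[? ?] [y' [z' [vy vz ? ? ?]]]] uv.
    by apply: (aE _ _ uy vz); split; apply/andP; split => /=; lra.
  by move=> xF x'F; have [/(key _ _ xF x'F)|/(key _ _ x'F xF)|] := ltgtP x x'.
apply: (sub_countable _ cF); apply: subset_card_le => x ncx.
apply: contrapT => nFx; apply: ncx.
pose G (a : rat) : set R := [set y | E (x, y) /\ ratr a < y < ratr a + e / 2].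
have cG : countable (\bigcup_a G a).
  apply: countable_bigcup_subsingletons => a.
  have key y z : G a y -> G a z -> ~ y < z.
    move=> [Ey /andP[ay ya]] [Ez /andP[az za]] yz; apply: nFx.
    have [b /andP[yb bz]] := ratI _ _ yz.
    have [c /andP[xc cx]] := ratI (x - e) x ltac:(lra).
    exists (c, b) => //; split; first by apply/andP; split=> //=; lra.
    by exists y, z; split => //; lra.
  move=> y z yG zG; have [/(key _ _ yG zG)|/(key _ _ zG yG)|] := ltgtP y z => //.
apply: (sub_countable _ cG); apply: subset_card_le => y /= Ey.
have [a /andP[ya ay]] := ratI (y - e / 2) y ltac:(lra).
by exists a => //; split => //; apply/andP; split => //; lra.
Qed.

End two_feebly_continuous_points.

Section planar_measure.
Variable R : realType.
Local Notation mu := (@lebesgue_measure R).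
Local Notation plane := (measurableTypeR R * measurableTypeR R)%type.

(** The product measure lives on the sigma-algebra generated by measurable
rectangles, which contains the open sets because they are countable unions of
rational squares. *)
Lemma open_measurable_plane (U : set (R * R)) :
  open U -> measurable (U : set plane).
Proof.
move=> oU.
pose b (i : rat * rat * nat) : set (R * R) :=
  ball (ratr i.1.1 : R, ratr i.1.2 : R) i.2.+1%:R^-1.
rewrite (_ : U = \bigcup_i [set p | b i `<=` U /\ b i p]); last first.
  apply/seteqP; split=> [p Up|p [i _ [iU ip]]]; last exact: iU.
  have [d [n [[[r1 _ rd1] [r2 _ rd2]] dp dU]]] :=
    dense_balls (dense_setX (@dense_rat R) (@dense_rat R))
      (open_nbhs_nbhs (conj oU Up)).
  exists (r1, r2, n) => //=.
  by rewrite /b /= rd1 rd2 -surjective_pairing.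
rewrite bigcup_unpickle; apply: bigcupT_measurable => n.
case: (unpickle n) => [i|] /=; last exact: measurable0.
have [iU|iU] := pselect (b i `<=` U); last first.
  rewrite (_ : [set p | _] = set0); first exact: measurable0.
  by apply/seteqP; split=> // p [].
rewrite (_ : [set p | _] = ball (ratr i.1.1 : R) i.2.+1%:R^-1 `*`
   ball (ratr i.1.2 : R) i.2.+1%:R^-1).
  by apply: measurableX; exact: measurable_realfun.measurable_ball.
by apply/seteqP; split=> p; [case|split].
Qed.

Lemma closed_null_sections (F : set (R * R)) : closed F ->
  countable [set x | ~ countable [set y | F (x, y)]] ->
  ((mu \x mu) F = 0)%E.
Proof.
move=> cF cx.
have mF : measurable (F : set plane).
  by rewrite -[F]setCK; apply: measurableC; apply: open_measurable_plane;
    exact: closed_openC.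
rewrite /product_measure1.
rewrite (@ae_eq_integral _ _ _ mu setT (cst 0%E)) ?integral0 //.
- exact: measurable_fun_xsection.
- exists [set x | ~ countable [set y | F (x, y)]]; split.
  + by apply: countable_measurable => // t; exact: measurable_set1.
  + exact: countable_lebesgue_measure0.
  + move=> x /= nx cFx; apply: nx => _ /=.
    apply: countable_lebesgue_measure0.
    by rewrite xsectionE.
Qed.

(** The closure is taken to get a measurable set, which is still an antichain. *)
Lemma antichain_negligible e (E : set (R * R)) : 0 < e -> local_antichain e E ->
  (mu \x mu)%E.-negligible E.
Proof.
move=> e0 /antichain_closure aE; exists (closure E); split.
- rewrite -[closure E]setCK; apply: measurableC; apply: open_measurable_plane.
  exact/closed_openC/closed_closure.
- apply: closed_null_sections; first exact: closed_closure.
  exact: antichain_xsection_countable aE.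
- exact: subset_closure.
Qed.

Theorem residual_TFC (f : R * R -> R) : residual (TFC f).
Proof.
apply: meager_sub_bigcup (@setC_TFC R f) => -[n r].
by apply: antichain_nowhere_dense (@antichain_setD_shadow R _ _);
  rewrite invr_gt0.
Qed.

Theorem full_measure_TFC (f : R * R -> R) : full_lebesgue_measure (TFC f).
Proof.
pose m : {measure set plane -> \bar R} := (mu \x mu)%E.
apply: (@negligibleS _ _ _ m _ _ (@setC_TFC R f)); rewrite bigcup_unpickle.
apply: negligible_bigcup => k.
case: (unpickle k) => [[n r]|] /=; last exact: negligible_set0.
by apply: antichain_negligible (@antichain_setD_shadow R _ _); rewrite invr_gt0.
Qed.

End planar_measure.

(** * Completeness of products and of closed subspaces *)

Lemma cauchy_image (U V : uniformType) (g : U -> V) (F : set_system U) :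
  Filter F -> unif_continuous g -> cauchy F -> cauchy (g @ F).
Proof.
move=> FF ug cF A /ug entA; rewrite near_simpl -near2E near_map2.
exact: cF entA.
Qed.

Section complete_prod.
Variables U V : completeType.

HB.instance Definition _ := Pointed.on (U * V)%type.

Lemma unif_continuous_fst : unif_continuous (@fst U V).
Proof.
move=> A entA; have := prod_entP entA (@entourageT V).
by apply: filterS => -[[a b] [c d]] [].
Qed.

Lemma unif_continuous_snd : unif_continuous (@snd U V).
Proof.
move=> A entA; have := prod_entP (@entourageT U) entA.
by apply: filterS => -[[a b] [c d]] [].
Qed.

Lemma prod_complete (F : set_system (U * V)) :
  ProperFilter F -> cauchy F -> cvg F.
Proof.
move=> FF cF.
have c1 : cauchy (fst @ F) by exact: cauchy_image unif_continuous_fst cF.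
have c2 : cauchy (snd @ F) by exact: cauchy_image unif_continuous_snd cF.
have [Fa Fb] := (cauchy_cvg _ c1, cauchy_cvg _ c2).
apply/cvg_ex; exists (lim (fst @ F), lim (snd @ F)) => A [[P Q] /= [aP bQ] PQA].
have {}Fa : F [set p | P p.1] := Fa _ aP.
have {}Fb : F [set p | Q p.2] := Fb _ bQ.
by apply: filterS (filterI Fa Fb) => p [? ?]; exact: PQA.
Qed.

HB.instance Definition _ := Uniform_isComplete.Build (U * V)%type prod_complete.

End complete_prod.

Section closed_subspace.
Context (X : completeType) (C : set X).

(** The type depends on the proof that [C] is closed and on the point [x0], since
a complete space comes with completeness and with a distinguished point. *)
Definition closed_subspace of closed C & set_type C : Type := set_type C.

Variables (cC : closed C) (x0 : set_type C).
Local Notation P := (closed_subspace cC x0).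

HB.instance Definition _ := Uniform.on P.
HB.instance Definition _ := isPointed.Build P x0.

Lemma unif_continuous_val : unif_continuous (val : P -> X).
Proof. by move=> A entA; exists A. Qed.

Lemma closed_subspace_complete (F : set_system P) :
  ProperFilter F -> cauchy F -> cvg F.
Proof.
move=> FF cF.
have cv : cauchy ((val : P -> X) @ F).
  exact: cauchy_image unif_continuous_val cF.
have Fl : cvg ((val : P -> X) @ F) by exact: cauchy_cvg cv.
set l := lim _ in Fl.
have Cl : C l.
  apply: cC => B /Fl FB; have [x Bx] := @filter_ex P F _ (val @^-1` B) FB.
  by exists (val x); split; first exact: set_mem (valP x).
apply/cvg_ex; exists (SigSub (mem_set Cl)) => A [_ [[B oB <-] Bl] BA].
exact: (@filterS P F _ _ _ BA (Fl _ (open_nbhs_nbhs (conj oB Bl)))).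
Qed.

HB.instance Definition _ := Uniform_isComplete.Build P closed_subspace_complete.

End closed_subspace.

HB.instance Definition _ (R : realType) (X : completePseudoMetricType R)
  (C : set X) (cC : closed C) (x0 : set_type C) :=
  PseudoMetric.copy (closed_subspace cC x0) (set_type C).

(* Lets type inference find the pseudometric and the completeness of a product as
a single structure. *)
HB.instance Definition _ (R : realType) (U V : completePseudoMetricType R) :=
  Complete.on (U * V)%type.

(** * Baire space *)

Definition baire := nat -> nat.

HB.instance Definition _ := Pointed.on baire.

Definition agree (n : nat) : set (baire * baire) :=
  [set xy | forall i, (i < n)%N -> xy.1 i = xy.2 i].

(** The product uniformity of discrete spaces, written without the pseudometric
below, which depends on the choice of the real numbers. *)
Definition baire_ent : set_system (baire * baire) :=
  filter_from setT agree.

Lemma agreeS m n : (m <= n)%N -> agree n `<=` agree m.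
Proof. by move=> mn xy xyn i im; apply: xyn; exact: leq_trans mn. Qed.

Local Open Scope relation_scope.

Lemma baire_ent_filter : Filter baire_ent.
Proof.
apply: filter_from_filter; first by exists 0%N.
move=> m n _ _; exists (maxn m n) => // xy xyn.
by split; apply: agreeS xyn; rewrite ?leq_maxl ?leq_maxr.
Qed.

Lemma baire_ent_diagonal A : baire_ent A -> diagonal `<=` A.
Proof. by move=> [n _ nA] xy /diagonalP e; apply: nA => i _; rewrite e. Qed.

Lemma baire_ent_inv A : baire_ent A -> baire_ent A^-1.
Proof. by move=> [n _ nA]; exists n => // xy xyn; apply: nA => i /xyn. Qed.

Lemma baire_ent_split A : baire_ent A -> exists2 B, baire_ent B & B \; B `<=` A.
Proof.
move=> [n _ nA]; exists (agree n); first by exists n.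
by move=> xy [z xz zy]; apply: nA => i ni; exact: etrans (xz i ni) (zy i ni).
Qed.

Local Close Scope relation_scope.

HB.instance Definition _ := isUniform.Build baire baire_ent_filter
  baire_ent_diagonal baire_ent_inv baire_ent_split.

Section baire_pseudometric.
Variable R : realType.

(** The ball of the ultrametric whose value is [1/(i+1)] for sequences first
differing at index [i]. *)
Definition baire_ball (x : baire) (e : R) (y : baire) : Prop :=
  0 < e /\ forall i : nat, e <= i.+1%:R^-1 -> x i = y i.

Lemma baire_ball_center x e : 0 < e -> baire_ball x e x.
Proof. by []. Qed.

Lemma baire_ball_sym x y e : baire_ball x e y -> baire_ball y e x.
Proof. by move=> [e0 xy]; split => // i /xy. Qed.

Lemma baire_ball_triangle x y z e1 e2 :
  baire_ball x e1 y -> baire_ball y e2 z -> baire_ball x (e1 + e2) z.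
Proof.
move=> [e10 xy] [e20 yz]; split=> [|i ei]; first exact: addr_gt0.
by transitivity (y i); [apply: xy|apply: yz]; apply: le_trans ei;
  rewrite ?lerDl ?lerDr ltW.
Qed.

Lemma baire_entourageE : entourage = entourage_ baire_ball.
Proof.
apply/seteqP; split=> A [].
  move=> n _ nA; exists n.+1%:R^-1; first by rewrite /= invr_gt0.
  move=> xy [_ xyn]; apply: nA => i ni; apply: xyn.
  by rewrite lef_pV2 ?posrE ?ler_nat // ltnS ltnW.
move=> e /= e0 eA; exists (Num.trunc e^-1).+1 => // xy xyn; apply: eA.
split=> // i ei; apply: xyn.
apply: ltnW; rewrite -(ltr_nat R); apply: le_lt_trans (truncnS_gt _).
by rewrite -[leLHS]invrK lef_pV2 ?posrE ?invr_gt0.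
Qed.

HB.instance Definition _ := Uniform_isPseudoMetric.Build R baire
  baire_ball_center baire_ball_sym baire_ball_triangle baire_entourageE.

End baire_pseudometric.

Lemma nbhs_agree (x : baire) (n : nat) : nbhs x [set y | agree n (x, y)].
Proof.
rewrite -nbhs_entourageE; exists (agree n); first by exists n.
by move=> y /xsectionP.
Qed.

Lemma nbhs_baireP (x : baire) (A : set baire) :
  nbhs x A <-> exists n, [set y | agree n (x, y)] `<=` A.
Proof.
split=> [|[n nA]]; last by apply: filterS (nbhs_agree x n).
rewrite -nbhs_entourageE => -[B [n _ nB] BA]; exists n => y xy.
by apply/BA/xsectionP/nB.
Qed.

Lemma near_coord (x : baire) (i : nat) : \forall y \near x, y i = x i.
Proof. by apply: filterS (nbhs_agree x i.+1) => y /(_ i (ltnSn i)) /esym. Qed.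

(** Each coordinate is eventually constant along a Cauchy filter, and the limit is
the sequence of these constants. *)
Lemma baire_complete (F : set_system baire) :
  ProperFilter F -> cauchy F -> cvg F.
Proof.
move=> FF cF.
have /choice[l Fl] : forall i, exists k, F [set x : baire | x i = k].
  move=> i.
  have [[P Q] /= [FP FQ] PQ] : filter_prod F F (agree i.+1).
    by apply: cF; exists i.+1.
  have [x Px] := filter_ex FP; exists (x i).
  by apply: filterS FQ => y Qy; exact/esym/(PQ (x, y) (conj Px Qy) i).
apply/cvg_ex; exists l => A /nbhs_baireP[n nA].
have : F [set y | agree n (l, y)].
  elim: n {nA} => [|n IH]; first by apply: filterS filterT.
  apply: filterS (filterI IH (Fl n)) => y [yn yln] i; rewrite ltnS leq_eqVlt.
  by move=> /predU1P[->|/yn].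
exact: filterS.
Qed.

HB.instance Definition _ := Uniform_isComplete.Build baire baire_complete.

HB.instance Definition _ (R : realType) := Complete.on baire.

Lemma baire_hausdorff : hausdorff_space baire.
Proof.
move=> x y xy; apply/funext => i.
by have [z [zx zy]] := xy _ _ (near_coord x i) (near_coord y i); rewrite -zx.
Qed.

Lemma baire_separable : separable baire.
Proof.
exists (range (fun s : seq nat => (nth 0%N s : baire))).
  exact: sub_countable (card_image_le _ _) (countableP _).
move=> O [x Ox] oO.
have /nbhs_baireP[n nO] := open_nbhs_nbhs (conj oO Ox).
exists (nth 0%N (mkseq x n)); split; last by exists (mkseq x n).
by apply: nO => i ni /=; rewrite nth_mkseq.
Qed.

(** All codings of Baire space used below, taking the tail of a sequence and
extracting a row of a double sequence, are of this form. *)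
Definition reindex (h : nat -> nat) (x : baire) : baire := x \o h.

Lemma reindex_continuous h : continuous (reindex h).
Proof.
move=> x A /nbhs_baireP[n nA].
apply/nbhs_baireP; exists (\max_(i < n) (h i).+1)%N => y xy.
apply: nA => i ni; apply: xy.
exact: (@leq_bigmax _ (fun i : 'I_n => (h i).+1) (Ordinal ni)).
Qed.

(** * Hausdorff products and closed subspaces *)

Lemma hausdorff_prod (X Y : topologicalType) :
  hausdorff_space X -> hausdorff_space Y -> hausdorff_space (X * Y)%type.
Proof.
move=> hX hY [x y] [x' y'] c; congr pair.
  apply: hX => A B xA x'B.
  by have [p [? ?]] := c _ _ (near_fst (p := (x, y)) xA)
    (near_fst (p := (x', y')) x'B); exists p.1.
apply: hY => A B yA y'B.
by have [p [? ?]] := c _ _ (near_snd (p := (x, y)) yA)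
  (near_snd (p := (x', y')) y'B); exists p.2.
Qed.

Lemma hausdorff_closed_subspace (X : completeType) (C : set X)
    (cC : closed C) (x0 : set_type C) :
  hausdorff_space X -> hausdorff_space (closed_subspace cC x0).
Proof.
move=> hX x y xy; apply: val_inj; apply: hX => A B.
rewrite !nbhsE => -[A' [oA Ax] A'A] [B' [oB By] B'B].
have [||z [Az Bz]] := xy (val @^-1` A') (val @^-1` B').
- by apply: open_nbhs_nbhs; split => //; exists A'.
- by apply: open_nbhs_nbhs; split => //; exists B'.
by exists (val z); split; [exact: A'A|exact: B'B].
Qed.

Lemma closed_subspace_val_continuous (X : completeType) (C : set X)
    (cC : closed C) (x0 : set_type C) :
  continuous (val : closed_subspace cC x0 -> X).
Proof. by move=> x; exact: initial_continuous. Qed.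

(** A point is chosen in the trace of every basic ball that meets the subspace. *)
Lemma separable_closed_subspace (R : realType) (X : completePseudoMetricType R)
    (C : set X) (cC : closed C) (x0 : set_type C) :
  separable X -> separable (closed_subspace cC x0).
Proof.
move=> [D cD dD].
pose P := closed_subspace cC x0.
have /choice[c cP] : forall i : X * nat, exists c : P,
    forall z : P, ball i.1 i.2.+1%:R^-1 (val z) -> ball i.1 i.2.+1%:R^-1 (val c).
  move=> i; have [[z iz]|nz] :=
    pselect (exists z : P, ball i.1 i.2.+1%:R^-1 (val z)); first by exists z.
  by exists x0 => z iz; case: nz; exists z.
exists (c @` (D `*` setT)).
  apply: (sub_countable (card_image_le _ _)); exact: countableX cD (countableP _).
move=> O [z Oz] [U oU UO].
have Uz : U (val z) by move: Oz; rewrite -UO.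
have [d [n [Dd dz dU]]] := dense_balls dD (open_nbhs_nbhs (conj oU Uz)).
exists (c (d, n)); split; last by exists (d, n).
rewrite -UO; exact: dU (cP (d, n) z dz).
Qed.

(** * Borel sets are analytic *)

Section souslin.
Variables (R : realType) (X : pseudoMetricType R).

(** Projections of closed sets along Baire space; unlike continuous images of
Polish spaces they allow countable operations without constructing new spaces. *)
Definition souslin (A : set X) : Prop :=
  exists2 C : set (X * baire), closed C & A = fst @` C.

Lemma souslin_closed (F : set X) : closed F -> souslin F.
Proof.
move=> cF; exists (fst @^-1` F).
  by apply: (closed_comp _ cF) => p _; exact: cvg_fst.
by apply/seteqP; split=> [x Fx|_ [p Fp <-]] //; exists (x, point).
Qed.

Lemma reindex_snd_continuous (h : nat -> nat) :
  continuous (fun p : X * baire => (p.1, reindex h p.2)).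
Proof.
move=> p; apply: (@cvg_pair _ _ _ _ (nbhs p.1) (nbhs (reindex h p.2))).
  exact: cvg_fst.
apply: (@continuous_comp _ _ _ snd); first exact: cvg_snd.
exact: reindex_continuous.
Qed.

(** The first entry of a sequence tells which set of the union is meant, and its
tail is the witness for that set. *)
Lemma souslin_bigcup (A : (set X)^nat) :
  (forall n, souslin (A n)) -> souslin (\bigcup_n A n).
Proof.
move=> /(_ _)/cid2 H; pose C n := s2val (H n).
have cC n : closed (C n) := s2valP (H n).
have AC n : A n = fst @` C n := s2valP' (H n).
exists [set p | C (p.2 0%N) (p.1, reindex S p.2)].
  (* the index [s 0] is locally constant, so nearby only [C (s 0)] matters *)
  rewrite -[X in closed X]setCK; apply: open_closedC.
  rewrite openE => -[x s] /= nC.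
  have oC : open [set p : X * baire | ~ C (s 0%N) (p.1, reindex S p.2)].
    apply: (@open_comp _ _ _ (~` C (s 0%N))) => [p _|].
      exact: reindex_snd_continuous.
    exact: closed_openC.
  have nearC := @open_nbhs_nbhs _ (x, s) _ (conj oC nC).
  have near0 : \forall p \near (x, s), p.2 0%N = s 0%N.
    exact: (near_snd (p := (x, s)) (near_coord s 0)).
  by apply: filterS (filterI nearC near0) => -[y t] [/= nCt t0]; rewrite /= t0.
apply/seteqP; split=> [x [n _]|_ [[x s] /= Cxs <-]].
  rewrite AC => -[[y s] Cs /= <-].
  by exists (y, (fun i => if i is j.+1 then s j else n) : baire).
by exists (s 0%N) => //; rewrite AC; exists (x, reindex S s).
Qed.

(** A single sequence carries the witnesses for all the sets, as the rows of a
double sequence. *)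
Lemma souslin_bigcap (A : (set X)^nat) :
  (forall n, souslin (A n)) -> souslin (\bigcap_n A n).
Proof.
move=> /(_ _)/cid2 H; pose C n := s2val (H n).
have cC n : closed (C n) := s2valP (H n).
have AC n : A n = fst @` C n := s2valP' (H n).
pose row (n i : nat) : nat := pickle (n, i).
exists (\bigcap_n [set p | C n (p.1, reindex (row n) p.2)]).
  apply: closed_bigI => n _; apply: (closed_comp _ (cC n)) => p _.
  exact: reindex_snd_continuous.
apply/seteqP; split=> [x Ax|_ [[x s] /= Cxs <-] n _]; last first.
  by rewrite AC; exists (x, reindex (row n) s) => //; exact: Cxs.
have /choice[s sP] : forall n, exists s, C n (x, s).
  by move=> n; have := Ax n I; rewrite AC => -[[y s] Cs /= <-]; exists s.
pose t : baire :=
  fun k => oapp (fun ni : nat * nat => s ni.1 ni.2) 0%N (unpickle k).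
exists (x, t) => //.
move=> n _ /=.
rewrite (_ : reindex _ _ = s n); first exact: sP.
by apply/funext => i; rewrite /reindex /= /t pickleK.
Qed.

(** The points whose ball of radius [1/(n+1)] lies in [U] may fail to form a
closed set, as balls need not be open, but their closure still lies in [U]. *)
Lemma open_Fsigma (U : set X) : open U -> Fsigma U.
Proof.
move=> oU; pose V (n : nat) := [set x | ball x n.+1%:R^-1 `<=` U].
exists (fun n => closure (V n)) => [n|]; first exact: closed_closure.
apply/seteqP; split=> [x Ux|x [n _ Vx]].
  have /nbhs_ballP[e /= e0 eU] := open_nbhs_nbhs (conj oU Ux).
  have [n] := ltr_add_invr e0; rewrite add0r => ne.
  exists n => //; apply: subset_closure => y xy; apply: eU.
  by apply: le_ball xy; exact: ltW.
have n0 : 0 < n.+1%:R^-1 :> R by rewrite invr_gt0.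
have [y [Vy xy]] := Vx _ (nbhsx_ballx x _ n0).
exact/Vy/ball_sym.
Qed.

(** Complements of such projections need not be such projections, so induction
over Borel sets has to carry the property for the set and its complement. *)
Lemma souslin_borel (A : set X) : <<s @open X >> A -> souslin A.
Proof.
suff : <<s @open X >> `<=` [set A | souslin A /\ souslin (~` A)].
  by move=> H /H[].
apply: smallest_sub; last first.
  move=> U oU; split; last by apply: souslin_closed; exact: open_closedC.
  have [F cF ->] := open_Fsigma oU.
  by apply: souslin_bigcup => n; exact: souslin_closed.
split=> [|B [sB sCB]|B sB].
- split; first by apply: souslin_closed; exact: closed0.
  by rewrite setC0; apply: souslin_closed; exact: closedT.
- by rewrite setTD /= setCK.
- split; first by apply: souslin_bigcup => n; case: (sB n).
  by rewrite setC_bigcup; apply: souslin_bigcap => n; case: (sB n).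
Qed.

End souslin.

(** The Polish space is the closed subset of [X * baire] projecting onto [A]. *)
Theorem borel_analytic (R : realType) (X : completePseudoMetricType R)
    (A : set X) :
  hausdorff_space X -> separable X -> <<s @open X >> A -> analytic R A.
Proof.
move=> hX sX /souslin_borel[C cC ->].
have [[p0 Cp0]|C0] := pselect (C !=set0); last first.
  by left; apply/seteqP; split=> // x [p Cp _]; apply: C0; exists p.
right.
pose p0' : set_type C := SigSub (mem_set Cp0).
exists (closed_subspace cC p0'), (fst \o val); split.
- apply: hausdorff_closed_subspace; apply: hausdorff_prod => //.
  exact: baire_hausdorff.
- apply: separable_closed_subspace; apply: separable_prod => //.
  exact: baire_separable.
- move=> p; have cval := @closed_subspace_val_continuous _ _ cC p0' p.
  by apply: (@continuous_comp _ _ _ _ fst p cval); exact: cvg_fst.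
- apply/seteqP; split=> [_ [p Cp <-]|_ [p _ <-]].
    by exists (SigSub (mem_set Cp)).
  by exists (val p) => //; exact: set_mem (valP p).
Qed.

(** By [TFC_bands] and the openness of shadows, [TFC f] is Borel as soon as the
bands are. *)
Theorem analytic_TFC (R : realType) (f : R * R -> R) :
  borel_function f -> analytic R (TFC f).
Proof.
move=> bf; apply: borel_analytic.
- by apply: hausdorff_prod; exact: Rhausdorff.
- by apply: separable_prod; exact: separable_real.
pose T : measurableType _ := g_sigma_algebraType (@open (R * R)%type).
have mband n r : measurable (band f n r : set T).
  have -> : band f n r = [set: T] `&` f @^-1` ball (ratr r : R) (n.+1%:R^-1 / 2).
    by rewrite setTI; apply/seteqP; split=> p; rewrite /band /= /ball /= distrC.
  by apply: bf => //; exact: measurable_realfun.measurable_ball.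
suff : measurable (TFC f : set T) by [].
rewrite TFC_bands; apply: bigcapT_measurable => n.
apply: bigcupT_measurable_rat => r; apply: measurableI; first exact: mband.
by apply: sub_sigma_algebra; exact: open_shadow.
Qed.

(** * The theorem *)

Theorem theorem12 (R : realType) (f : R * R -> R) :
  [/\ residual (TFC f),
      full_lebesgue_measure (TFC f) &
      borel_function f -> analytic R (TFC f)].
Proof.
split; [exact: residual_TFC|exact: full_measure_TFC|exact: analytic_TFC].
Qed.
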